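(* Let $\chi$ be chosen uniformly at random from the set of irreducible characters of the alternating group $\mathfrak A_n$ and let $g$ be chosen (independently) uniformly at random from $\mathfrak A_n$. Then the probability that $\chi(g)=0$ tends to $1$ as $n\to\infty$; that is, $$\frac{|\{(\chi,g)\in \mathrm{Irr}(\mathfrak A_n)\times\mathfrak A_n : \chi(g)=0\}|}{|\mathrm{Irr}(\mathfrak A_n)|\cdot |\mathfrak A_n|}\to 1\quad\text{as } n\to\infty.$$
   Context: $\mathfrak A_n$ is the alternating group on $n$ letters, and $\mathrm{Irr}(G)$ denotes the (finite) set of irreducible complex characters of a finite group $G$. *)

(* Defs.v *)
From HB Require Import structures.
From mathcomp Require Import all_boot all_order all_algebra all_fingroup.
From mathcomp Require Import all_solvable all_field all_character.
From mathcomp Require Import reals topology normedtype sequences.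

Set Implicit Arguments.
Unset Strict Implicit.
Unset Printing Implicit Defensive.

Import Order.TTheory GRing.Theory Num.Theory.
Local Open Scope ring_scope.

(* [Iirr G] indexes the irreducible characters of G bijectively ([irr_inj]);   *)
(* a complex character takes its values in [algC]. A class function on G is    *)
(* extended by 0 to the ambient type [gT], so [p.2 \in G] cannot be dropped    *)
(* when G is a proper subgroup.                                                *)
Definition irr_zeros (gT : finGroupType) (G : {group gT}) :
    {set Iirr G * gT} :=
  [set p | (p.2 \in G) && ('chi[G]_(p.1) p.2 == 0)].

(* Main.v *)
Require Import Defs.
From HB Require Import structures.
From mathcomp Require Import all_boot all_order all_algebra all_fingroup.
From mathcomp Require Import all_solvable all_field all_character.
From mathcomp Require Import reals topology normedtype sequences.
From mathcomp Require Import zify ring.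
Import Order.TTheory GRing.Theory Num.Theory.
Import numFieldNormedType.Exports.
Local Open Scope classical_set_scope.
Local Open Scope ring_scope.

Set Implicit Arguments.
Unset Strict Implicit.
Unset Printing Implicit Defensive.

(* Centralizers of typical permutations are much smaller than the number of   *)
(* irreducible characters. For any finite group, the second orthogonality     *)
(* relation and a Galois-conjugation argument show that at most |C_G(g)|      *)
(* irreducible characters are nonzero at g. If g permutes n points with c     *)
(* cycles, then |C(g)| <= n^c, since a permutation commuting with g is        *)
(* determined by its values at one point of each cycle. By Burnside's         *)
(* orbit-counting lemma for the action of S_n on subsets, the average of 2^c  *)
(* is at most n + 1, hence c < 2 log_2 n + O(1) outside a proportion O(1/n)   *)
(* of the group, and there |C(g)| <= 2^(O(log^2 n)). On the other hand A_n    *)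
(* has at least 2^(c' sqrt n) conjugacy classes, as one sees from products of *)
(* disjoint cycles of distinct odd lengths, which are even permutations.      *)

(** Pairs with nonzero value are counted for each g separately. With k irreducible characters,
    [card_nonzeros_Alt] charges at most n^L to each g having at most L cycles, by [card_irr_neq0]
    and [card_cent1_perm], and k * 2^(c - L) to a g with c > L cycles, summed by
    [sum_expn_card_porbits]. For L about 2 log_2 n the second share is O(1/n) of all pairs; so is
    the first, since [card_classes_Alt_ge] makes k exceed n^(L + 1). Hence the bound 3/(n + 1) of
    [leq_nonzeros_Alt]. *)

Lemma char_expg_aut (gT : finGroupType) (G : {group gT}) (chi : 'CF(G)) x k :
    chi \is a character -> x \in G -> coprime k #[x]%g ->
  exists u : {rmorphism algC -> algC}, chi (x ^+ k)%g = u (chi x).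
Proof.
(* On [<[x]>] a character is a sum of linear ones, whose values at [x] are roots of unity of order
   dividing [#[x]]; [u] raises these to the power [k]. *)
move=> Nchi Gx cokx; have [u Du] := Qn_aut_exists cokx; exists u.
have sxG: <[x]>%g \subset G by rewrite cycle_subG.
rewrite -!(cfResE chi sxG) ?mem_cycle ?cycle_id //.
have [r ->] := char_sum_irr (cfRes_char <[x]>%g Nchi).
rewrite !sum_cfunE rmorph_sum /=; apply: eq_bigr => i _.
have Li: 'chi_i \is a linear_char by rewrite irr_cyclic_lin ?cycle_cyclic.
rewrite lin_charX ?cycle_id // Du //.
by rewrite -lin_charX ?cycle_id // expg_order lin_char1.
Qed.


(* |chi|^2 averages to at least 1 over the generators of <[x]>, by AM-GM and    *)
(* integrality of the product of Galois conjugates; all generators of <[x]>    *)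
(* have the same centralizer as x.                                             *)
Lemma card_irr_neq0 (gT : finGroupType) (G : {group gT}) x :
  x \in G -> (#|[set i | 'chi[G]_i x != 0%R]| <= #|'C_G[x]%g|)%N.
Proof.
move=> Gx; pose S := [pred s | generator <[x]>%g s].
have sxG: <[x]>%g \subset G by rewrite cycle_subG.
have Sgt0: (0 < #|S|)%N by apply/card_gt0P; exists x; apply: generator_cycle.
have SG s: s \in S -> s \in G by move/cycle_generator/(subsetP sxG).
have cards s: s \in S -> \sum_i `|'chi[G]_i s| ^+ 2 = #|'C_G[x]%g|%:R.
  move=> Ss; have /eqP defS : <[x]>%g == <[s]>%g by [].
  rewrite -(cent_cycle x) defS cent_cycle.
  under eq_bigr do rewrite normCK.
  by rewrite second_orthogonality_relation ?SG // class_refl.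
rewrite -(leq_pmul2r Sgt0) -(ler_nat algC) !natrM.
have <-: \sum_(s in S) \sum_i `|'chi[G]_i s| ^+ 2 = #|'C_G[x]%g|%:R * #|S|%:R.
  by rewrite (eq_bigr _ cards) sumr_const mulr_natr.
rewrite exchange_big /= (bigID [in [set i | 'chi[G]_i x != 0]]) /=.
rewrite -[leLHS]addr0; apply: lerD; last first.
  by apply: sumr_ge0 => i _; apply: sumr_ge0 => s _; rewrite exprn_ge0.
rewrite mulr_natl -sumr_const; apply: ler_sum => i; rewrite inE => nz_i.
under eq_bigr => s Ss do rewrite -(cfResE _ sxG (cycle_generator Ss)).
apply: sum_norm2_char_generators => [|s Ss].
  by rewrite cfRes_char ?irr_char.
(* The value at [s] is a Galois conjugate of the nonzero value at [x]. *)
have /cycleP[k Ds] := cycle_generator Ss.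
rewrite cfResE ?cycle_generator // Ds.
have [|u ->] := char_expg_aut (irr_char i) Gx (_ : coprime k #[x]%g).
  by move: Ss; rewrite inE /= Ds generator_coprime coprime_sym.
by rewrite fmorph_eq0.
Qed.

(** * Centralizers and cycle counts of permutations *)

Lemma card_cent1_perm (T : finType) (s : {perm T}) :
  (#|'C[s]%g| <= #|T| ^ #|porbits s|)%N.
Proof.
have [T0 | /card_gt0P[x0 _]] := posnP #|T|.
  have P0 : porbits s = set0.
    by apply/setP=> A; rewrite inE; apply/imsetP => -[x]; have := card0_eq T0 x.
  rewrite P0 cards0 expn0; have <- : #|[set: {perm T}]| = 1%N.
    by rewrite (card_Sym T) T0.
  by apply/subset_leq_card/subsetT.
pose P := {A | A \in porbits s}; pose r (A : {set T}) := odflt x0 [pick x in A].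
have rP x : r (porbit s x) \in porbit s x.
  by rewrite /r; case: pickP => // /(_ x); rewrite porbit_id.
have <- : #|{ffun P -> T}| = (#|T| ^ #|porbits s|)%N.
  by rewrite card_ffun card_sig.
pose f (t : {perm T}) := [ffun A : P => t (r (val A))].
rewrite -(@card_in_imset _ _ f); first exact: max_card.
move=> t u /cent1P cts /cent1P cus /ffunP eq_f; apply/permP=> x.
have Px : porbit s x \in porbits s by apply: imset_f.
have := eq_f (Sub (porbit s x) Px); rewrite !ffunE /= => eq_r.
have := rP x; rewrite porbit_sym => /porbitP[k ->].
by rewrite -!permM -(commuteX k cts) -(commuteX k cus) !permM eq_r.
Qed.

(** Unions of cycles are stable under [s], and distinct families of cycles have distinct unions
    because cycles partition [T]. *)
Lemma expn_card_porbits (T : finType) (s : {perm T}) :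
  (2 ^ #|porbits s| <= #|[set A : {set T} | s @: A == A]|)%N.
Proof.
rewrite -card_powerset -(@card_in_imset _ _ (@cover T)).
  apply/subset_leq_card/subsetP=> _ /imsetP[P + ->]; rewrite powersetE => sP.
  rewrite inE eqEcard card_imset ?leqnn ?andbT; last exact: perm_inj.
  apply/subsetP=> _ /imsetP[x /bigcupP[A PA Ax] ->].
  apply/bigcupP; exists A => //.
  have /imsetP[y _ dA] := subsetP sP A PA; move: Ax.
  rewrite dA -!eq_porbit_mem => /eqP <-; have := porbit_perm s 1 x.
  by rewrite expg1 => ->.
have sub (P Q : {set {set T}}) : P \subset porbits s -> Q \subset porbits s ->
    cover P = cover Q -> P \subset Q.
  move=> sP sQ eqPQ; apply/subsetP=> A PA.
  have /imsetP[x _ dA] := subsetP sP A PA.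
  have : x \in cover P by apply/bigcupP; exists A; rewrite // dA porbit_id.
  rewrite eqPQ => /bigcupP[B QB xB]; have /imsetP[y _ dB] := subsetP sQ B QB.
  by move: xB; rewrite dB -eq_porbit_mem -dA -dB => /eqP ->.
move=> P Q; rewrite !powersetE => sP sQ eqPQ.
by apply/eqP; rewrite eqEsubset; apply/andP; split; apply: sub.
Qed.

Lemma perm_imset_exists (T : finType) (A B : {set T}) :
  #|A| = #|B| -> exists s : {perm T}, s @: A = B.
Proof.
(* The permutation matches two listings of [T], one starting with [A] and the other with [B],
   position by position. *)
move=> cAB; pose e (C : {set T}) := enum C ++ enum (~: C).
have szC C : size (e C) = #|T| by rewrite size_cat -!cardE cardsC.
have memC C x : x \in e C by rewrite mem_cat !mem_enum !inE orbN.
have uC C : uniq (e C).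
  rewrite cat_uniq !enum_uniq /= andbT; apply/hasPn=> x.
  by rewrite !mem_enum inE.
have f_inj : injective (fun x => nth x (e B) (index x (e A))).
  move=> x y /eqP; rewrite (set_nth_default x y) ?szC -?(szC A) ?index_mem //.
  rewrite nth_uniq ?szC -?(szC A) ?index_mem // => /eqP/(congr1 (nth x (e A))).
  by rewrite !nth_index.
exists (perm f_inj); apply/eqP; rewrite eqEcard card_imset ?cAB ?leqnn ?andbT.
  apply/subsetP=> _ /imsetP[x Ax ->]; rewrite permE -mem_enum.
  have xA : x \in enum A by rewrite mem_enum.
  have ltx : (index x (enum A) < #|B|)%N by rewrite -cAB cardE index_mem.
  by rewrite index_cat xA nth_cat -cardE ltx mem_nth // -cardE.
exact: perm_inj.
Qed.

(** Burnside's lemma: an orbit on subsets is determined by the cardinality of its members, so there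
    are at most [#|T|.+1] orbits. *)
Lemma sum_expn_card_porbits (T : finType) :
  (\sum_(s : {perm T}) 2 ^ #|porbits s| <= #|T|.+1 * #|T|`!)%N.
Proof.
pose to := ('P^*)%act : {action {perm T} &-> {set T}}.
have acT : [acts [set: {perm T}], on [set: {set T}] | to].
  by apply/actsP=> s _ A; rewrite !inE.
have cG : #|[set: {perm T}]| = #|T|`!%N by apply: card_Sym.
have := Frobenius_Cauchy acT; rewrite cG => defsum.
apply: (@leq_trans (#|orbit to [set: {perm T}] @: [set: {set T}]| * #|T|`!)).
  rewrite -defsum big_mkcond /= [leqRHS]big_mkcond /=; apply: leq_sum => s _.
  rewrite inE; apply: leq_trans (expn_card_porbits s) _.
  apply/subset_leq_card/subsetP=> A; rewrite inE => /eqP sA.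
  by apply/setIP; split; [rewrite inE|apply/afix1P; rewrite /= setactE].
rewrite leq_mul2r; apply/orP; right.
have ord_card (A : {set T}) : (#|A| < #|T|.+1)%N by rewrite ltnS max_card.
pose h (X : {set {set T}}) : 'I_#|T|.+1 := inord #|odflt set0 [pick A in X]|.
rewrite -[leqRHS]card_ord -(@card_in_imset _ _ h); first exact: max_card.
move=> _ _ /imsetP[A _ ->] /imsetP[B _ ->].
rewrite /h; case: pickP => [A' | /(_ A)]; last by rewrite orbit_refl.
case: pickP => [B' | /(_ B)]; last by rewrite orbit_refl.
move=> /orbit_eqP oB /orbit_eqP oA /(congr1 val).
rewrite /= !inordK // => /perm_imset_exists[s sA].
rewrite -oB -oA; apply/esym/orbit_eqP/orbitP.
by exists s; rewrite ?inE //= setactE.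
Qed.

(** * Many conjugacy classes in the alternating group *)

(** For positive [d], some cycle has length exactly [d]: a conjugacy invariant that will separate
    classes. *)
Definition has_cycle (T : finType) (s : {perm T}) (d : nat) : Prop :=
  exists x, (s ^+ d)%g x = x /\ forall k, (0 < k < d)%N -> (s ^+ k)%g x <> x.

(* The naturals are cut into blocks [q * w, (q + 1) * w). When A q holds, the  *)
(* first 2q + 1 elements of block q are permuted cyclically.                   *)
Definition block_shift (w : nat) (A : pred nat) (x : nat) : nat :=
  if A (x %/ w)%N && (x %% w < (x %/ w).*2.+1)%N
  then (x %/ w * w + (x %% w).+1 %% (x %/ w).*2.+1)%N else x.

Section BlockShift.
Variables (w : nat) (A : pred nat).
Hypothesis A_lt : forall q, A q -> (q.*2.+1 <= w)%N.

Lemma iter_block_shift k q r : A q -> (r < q.*2.+1)%N ->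
  iter k (block_shift w A) (q * w + r) = (q * w + (r + k) %% q.*2.+1)%N.
Proof.
move=> Aq ltr; have lew := A_lt Aq; have w_gt0 : (0 < w)%N by lia.
elim: k => [|k /= ->]; first by rewrite addn0 modn_small.
have ltm : ((r + k) %% q.*2.+1 < q.*2.+1)%N by rewrite ltn_pmod.
rewrite addnS -[in RHS]addn1 -[in RHS]modnDml [in RHS]addn1.
move: (_ %% _)%N ltm => m ltm; have ltmw : (m < w)%N by lia.
rewrite /block_shift divnMDl // modnMDl divn_small // addn0.
by rewrite (modn_small ltmw) Aq ltm.
Qed.

Variant block_shift_spec x : Prop :=
  | BlockShiftIn q r of A q & (r < q.*2.+1)%N & x = (q * w + r)%N
  | BlockShiftOut of block_shift w A x = x.

Lemma block_shiftP x : block_shift_spec x.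
Proof.
have [/andP[Aq ltr] | out] :=
    boolP (A (x %/ w) && (x %% w < (x %/ w).*2.+1))%N.
  by apply: BlockShiftIn Aq ltr _; apply: divn_eq.
by apply: BlockShiftOut; rewrite /block_shift (negbTE out).
Qed.

(** An odd common multiple of the cycle lengths. Being a period, it yields injectivity; being odd,
    it makes the permutation even. *)
Definition block_period : nat := \prod_(q < w) q.*2.+1.

Lemma odd_block_period : odd block_period.
Proof.
rewrite /block_period; elim/big_rec: _ => // i x _.
by rewrite oddM /= odd_double.
Qed.

Lemma iter_block_period x : iter block_period (block_shift w A) x = x.
Proof.
case: (block_shiftP x) => [q r Aq ltr -> | fix_x]; last exact: iter_fix.
have ltqw : (q < w)%N by have := A_lt Aq; lia.
have /eqP dvd : (q.*2.+1 %| block_period)%N.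
  by rewrite /block_period (bigD1 (Ordinal ltqw)) //= dvdn_mulr.
by rewrite iter_block_shift // -modnDmr dvd addn0 modn_small.
Qed.

Lemma block_shift_inj : injective (block_shift w A).
Proof.
have [N defN] : exists N, block_period = N.+1.
  by move: odd_block_period; case: block_period => // N; exists N.
move=> x y eq_xy; rewrite -[x]iter_block_period -[y]iter_block_period.
by rewrite defN !iterSr eq_xy.
Qed.

Variable n : nat.
Hypothesis A_le : forall q, A q -> (q.+1 * w <= n)%N.

Lemma block_shift_lt x : (x < n)%N -> (block_shift w A x < n)%N.
Proof.
case: (block_shiftP x) => [q r Aq ltr -> _ | -> //].
have := @iter_block_shift 1 _ _ Aq ltr; rewrite /= => ->.
apply: leq_trans (A_le Aq); rewrite mulSn addnC ltn_add2r.
by apply: leq_trans (A_lt Aq); rewrite ltn_pmod.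
Qed.

Definition block_shift_ord (x : 'I_n) : 'I_n :=
  Ordinal (block_shift_lt (ltn_ord x)).

Lemma block_shift_ord_inj : injective block_shift_ord.
Proof. by move=> x y /(congr1 val)/block_shift_inj/val_inj. Qed.

Definition block_perm : {perm 'I_n} := perm block_shift_ord_inj.

Lemma block_permX k x :
  (block_perm ^+ k)%g x = iter k (block_shift w A) x :> nat.
Proof. by rewrite permX; elim: k => //= k <-; rewrite permE. Qed.

Lemma block_perm_Alt : block_perm \in ('Alt_('I_n))%g.
Proof.
rewrite Alt_even; apply/negP=> odd_s.
have odd_sX k : odd_perm (block_perm ^+ k)%g = odd k.
  elim: k => [|k IHk]; rewrite ?expg0 ?odd_perm1 //.
  by rewrite expgS odd_permM odd_s IHk.
have := odd_sX block_period; rewrite odd_block_period.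
suff -> : (block_perm ^+ block_period = 1)%g by rewrite odd_perm1.
apply/permP=> x; apply/val_inj.
by rewrite /= block_permX iter_block_period perm1.
Qed.

(** Cycles come from distinct blocks and have distinct lengths. Length 1 is excluded since fixed
    points may lie outside the chosen blocks. *)
Lemma has_cycle_block_perm q :
  (0 < q)%N -> has_cycle block_perm q.*2.+1 <-> A q.
Proof.
move=> q_gt0; split=> [[x [fix_x nfix_x]] | Aq]; last first.
  have ltqw : (q * w < n)%N.
    by have := A_le Aq; have := A_lt Aq; rewrite mulSn; lia.
  exists (Ordinal ltqw).
  have itq k :
      iter k (block_shift w A) (q * w)%N = (q * w + k %% q.*2.+1)%N.
    by rewrite -[in LHS](addn0 (q * w)%N) iter_block_shift.
  split=> [|k ltk eqk].
    by apply/val_inj; rewrite /= block_permX [LHS]itq modnn addn0.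
  have := congr1 val eqk; rewrite /= block_permX [LHS]itq modn_small; lia.
have {}fix_x : iter q.*2.+1 (block_shift w A) x = x.
  by rewrite -block_permX fix_x.
have {}nfix_x k : (0 < k < q.*2.+1)%N -> iter k (block_shift w A) x <> x.
  by move=> ltk; rewrite -block_permX => /val_inj; apply: nfix_x.
case: (block_shiftP x) fix_x nfix_x => [p r Ap ltr -> | fix1 _ nfix].
  rewrite iter_block_shift // => /addnI.
  rewrite -[in RHS](modn_small ltr) -[in RHS](addn0 r) => /eqP.
  rewrite eqn_modDl mod0n.
  move=> dvd nfix; have le_pq := dvdn_leq (ltn0Sn _) dvd.
  have [lt_pq | ge_pq] := ltnP p.*2.+1 q.*2.+1; last by have -> : q = p by lia.
  by case: (nfix p.*2.+1 lt_pq); rewrite iter_block_shift // modnDr modn_small.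
by case: (nfix 1%N) => //=; lia.
Qed.

End BlockShift.

Lemma has_cycleJ (T : finType) (s t : {perm T}) d :
  has_cycle s d -> has_cycle (s ^ t)%g d.
Proof.
case=> x [fix_x nfix_x]; exists (t x); split=> [|k ltk].
  by rewrite -conjXg permJ fix_x.
by rewrite -conjXg permJ => /perm_inj; apply: nfix_x.
Qed.

Lemma card_classes_Alt_ge m n : (m.+1 * m.*2.+1 <= n)%N ->
  (2 ^ m <= #|classes ('Alt_('I_n))%g|)%N.
Proof.
move=> le_mn; set w := m.*2.+1 in le_mn.
(* The element i of [B] selects block i + 1, avoiding block 0, whose cycle would be trivial. *)
pose A (B : {set 'I_m}) : pred nat :=
  [pred q | [exists i in B, val i == q.-1] && (0 < q)%N].
have leA B q : A B q -> (q <= m)%N.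
  by case/andP=> /exists_inP[i _ /eqP /= defq] _; have := ltn_ord i; lia.
have A_lt B q : A B q -> (q.*2.+1 <= w)%N by move/leA; rewrite /w; lia.
have A_le B q : A B q -> (q.+1 * w <= n)%N.
  by move/leA=> le_qm; apply: leq_trans le_mn; rewrite leq_mul.
pose s B := block_perm (A_lt B) (A_le B).
pose f B := (s B ^: 'Alt_('I_n))%g.
have <- : #|{set 'I_m}| = (2 ^ m)%N.
  by rewrite -cardsT -powersetT card_powerset cardsT card_ord.
rewrite -cardsT -(@card_imset _ _ f).
  apply/subset_leq_card/subsetP=> _ /imsetP[B _ ->].
  by rewrite mem_classes ?block_perm_Alt.
have sub B C : f B = f C -> B \subset C.
  move=> eqf; apply/subsetP=> i Bi.
  have : s B \in f C by rewrite -eqf class_refl.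
  case/imsetP=> t _ defs.
  have AB : A B i.+1 by apply/andP; split=> //; apply/exists_inP; exists i.
  have /(has_cycleJ t^-1) :=
    (has_cycle_block_perm (A_lt B) (A_le B) (ltn0Sn i)).2 AB.
  rewrite -/(s B) defs conjgK => /has_cycle_block_perm.
  case/(_ isT)/andP=> /exists_inP[j Cj /eqP/val_inj <-] //.
by move=> B C eqf; apply/eqP; rewrite eqEsubset; apply/andP; split; apply: sub.
Qed.

(** * Counting nonzero values and passing to the limit *)

Lemma card_irr_zerosC (gT : finGroupType) (G : {group gT}) :
  (#|irr_zeros G| + \sum_(g in G) #|[set i | 'chi[G]_i g != 0%R]|
     = #|Iirr G| * #|G|)%N.
Proof.
have -> : #|irr_zeros G| = (\sum_(g in G) #|[set i | 'chi[G]_i g == 0%R]|)%N.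
  transitivity (\sum_(g in G) \sum_(i | 'chi[G]_i g == 0%R) 1)%N; last first.
    by apply: eq_bigr => g _; rewrite sum1dep_card.
  rewrite (exchange_big_dep xpredT) //= pair_big_dep sum1_card /=.
  by apply: eq_card => -[i g]; rewrite !inE.
rewrite -big_split /= mulnC -sum_nat_const; apply: eq_bigr => g _.
rewrite -(cardsC [set i | 'chi[G]_i g == 0%R]); congr (_ + _)%N.
by apply: eq_card => i; rewrite !inE.
Qed.

(** A Markov argument on 2^c, where c is the number of cycles, cut at c = [L]. The factor 2 in
    [(n.+1).*2] is the index of the alternating group. *)
Lemma card_nonzeros_Alt n L : (1 < n)%N ->
  ((\sum_(g in ('Alt_('I_n))%g) #|[set i | 'chi[('Alt_('I_n))%G]_i g != 0%R]|)
     * 2 ^ L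
    <= #|('Alt_('I_n))%g| * (n ^ L * 2 ^ L
                                + #|Iirr ('Alt_('I_n))%g| * (n.+1).*2))%N.
Proof.
move=> n_gt1; set A := ('Alt_('I_n))%G; set k := #|Iirr A|.
have cA : (2 * #|A| = n`!)%N by rewrite card_Alt card_ord.
apply: (@leq_trans (\sum_(g in A) (n ^ L * 2 ^ L + k * 2 ^ #|porbits g|))).
  rewrite big_distrl /=; apply: leq_sum => g Ag.
  have [leL | /ltnW leL] := leqP #|porbits g| L; last first.
    apply: leq_trans (leq_addl _ _); apply: leq_mul; first exact: max_card.
    by rewrite leq_exp2l.
  apply: leq_trans (leq_addr _ _); rewrite leq_mul2r; apply/orP; right.
  apply: leq_trans (card_irr_neq0 Ag) _.
  apply: leq_trans (subset_leq_card (subsetIr _ _)) _.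
  apply: leq_trans (card_cent1_perm g) _; rewrite card_ord leq_exp2l //.
rewrite big_split /= sum_nat_const mulnDr leq_add2l -big_distrr /=.
rewrite mulnCA leq_mul2l; apply/orP; right.
apply: (@leq_trans (\sum_(g : {perm 'I_n}) 2 ^ #|porbits g|)).
  by rewrite [leqRHS](bigID [in A]) /= leq_addr.
apply: leq_trans (sum_expn_card_porbits _) _.
by rewrite card_ord -cA -muln2 mulnA mulnC (mulnC n.+1).
Qed.

Lemma expn2_bound b : (11 <= b)%N -> (2 * (b.*2.+4) ^ 2 + b.*2.+4 < 2 ^ b)%N.
Proof.
move=> le_b; rewrite -(subnK le_b); elim: (b - 11)%N => [|c IHc].
  by vm_compute.
rewrite addSn (expnS 2); move: IHc; set d := (c + 11)%N => IHc.
have : (26 <= d.*2.+4)%N by rewrite /d; lia.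
rewrite doubleS; move: (2 ^ d)%N (d.*2.+4) IHc => P y; rewrite -!mulnn; nia.
Qed.

Lemma leq_nonzeros_Alt n : (24 <= trunc_log 2 n)%N ->
  ((\sum_(g in ('Alt_('I_n))%g) #|[set i | 'chi[('Alt_('I_n))%G]_i g != 0%R]|)
     * n.+1
    <= 3 * (#|Iirr ('Alt_('I_n))%g| * #|('Alt_('I_n))%g|))%N.
Proof.
set a := trunc_log 2 n => a_ge; set A := ('Alt_('I_n))%G; set k := #|Iirr A|.
have n_gt0 : (0 < n)%N by case: (n) @a a_ge => //; rewrite trunc_log0.
have le_an : (2 ^ a <= n)%N by apply: trunc_logP.
have lt_na : (n < 2 ^ a.+1)%N by apply: trunc_log_ltn.
have n_gt1 : (1 < n)%N.
  by apply: leq_trans le_an; apply: (@leq_pexp2l 2 1) => //; lia.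
(* Taking m = 2^b - 1 in [card_classes_Alt_ge] uses fewer than 2^(2b + 2) points, which is at most
   n. *)
pose b := (a.-2)./2; have b_ge : (11 <= b)%N by rewrite /b; lia.
have [le_ba le_ab] : (b.*2.+2 <= a /\ a <= b.*2.+3)%N by rewrite /b; lia.
have k_ge : (2 ^ (2 ^ b).-1 <= k)%N.
  rewrite /k card_ord NirrE; apply: card_classes_Alt_ge.
  apply: leq_trans le_an; apply: leq_trans (leq_pexp2l _ le_ba) => //.
  have : (0 < 2 ^ b)%N by rewrite expn_gt0.
  rewrite !expnS -[b.*2]addnn expnD; move: (2 ^ b)%N; nia.
have nL_le : (n.+1 * n ^ a.+1.*2 <= k)%N.
  apply: leq_trans k_ge; apply: (@leq_trans ((2 ^ a.+1) ^ (a.+1.*2).+1)).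
    by rewrite expnS leq_mul // leq_exp2r // ltnW.
  (* With y = a + 1, at most 2b + 4, the exponent on the left is 2y^2 + y. *)
  rewrite -expnM leq_exp2l //; have := expn2_bound b_ge.
  move: (2 ^ b)%N => B; rewrite -mulnn; nia.
have n2_le : (n.+1 * n.+1 <= 2 ^ a.+1.*2)%N by rewrite -addnn expnD leq_mul.
have P_gt0 : (0 < 2 ^ a.+1.*2)%N by rewrite expn_gt0.
rewrite -(leq_pmul2r P_gt0) {P_gt0}.
have := card_nonzeros_Alt a.+1.*2 n_gt1; rewrite -/A -/k.
move: (\sum_(g in _) _)%N (2 ^ _)%N (n ^ _)%N #|A| k nL_le n2_le {k_ge}.
move=> S P M c k nM_le n2_le le_S; rewrite mulnAC.
apply: leq_trans (leq_mul le_S (leqnn _)) _.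
have -> : (c * (M * P + k * (n.+1).*2) * n.+1
           = c * (n.+1 * M * P + k * (2 * (n.+1 * n.+1))))%N.
  by rewrite -muln2; ring.
have -> : (3 * (k * c) * P = c * (k * P + k * (2 * P)))%N by ring.
by rewrite leq_mul // leq_add ?leq_mul.
Qed.

Theorem mainTheorem2 (R : realType) :
  (fun n : nat =>
     #|irr_zeros ('Alt_('I_n))%G|%:R
       / (#|Iirr ('Alt_('I_n))%g|%:R * #|('Alt_('I_n))%g|%:R) : R)
    @ \oo --> (1 : R).
Proof.
have cvg3 : (fun n : nat => 1 - 3 * n.+1%:R^-1 : R) @ \oo --> (1 : R).
  rewrite -[X in _ --> X]subr0 -[X in _ --> _ - X](mulr0 3).
  apply: cvgB; first exact: cvg_cst.
  by apply: cvgMr; exact: cvg_harmonic.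
(* The ratio lies between 1 - 3/(n + 1) and 1 once n is at least 2^24. *)
apply: (squeeze_cvgr _ cvg3 (@cvg_cst _ _ _ _ _)); near=> n.
have big_n : (24 <= trunc_log 2 n)%N.
  apply: trunc_log_max => //; near: n; by exists (2 ^ 24)%N.
have le_nz := leq_nonzeros_Alt big_n; have := card_irr_zerosC ('Alt_('I_n))%G.
move: le_nz; set S := (\sum_(g in _) _)%N; set Z := #|irr_zeros _|.
set k := #|Iirr _|; set c := #|_|; move=> le_nz eqZ.
have kc_gt0 : (0 : R) < k%:R * c%:R.
  by apply: mulr_gt0; rewrite ltr0n ?cardG_gt0 // /k card_ord.
have {}eqZ : Z%:R + S%:R = k%:R * c%:R :> R by rewrite -natrD eqZ natrM.
apply/andP; split; last first.
  by rewrite ler_pdivrMr // mul1r -eqZ lerDl.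
rewrite ler_pdivlMr // -[Z%:R](addrK S%:R) eqZ mulrBl mul1r lerD2l lerN2.
by rewrite mulrAC ler_pdivlMr ?ltr0n // -!natrM ler_nat.
Unshelve. all: by end_near.
Qed.
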